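(* Let $X$ be a locally convex Hausdorff topological vector space, $g:X\to\overline{\mathbb R}$ a lower semicontinuous, proper, convex function, $h:X\to\overline{\mathbb R}$ a proper generalized polyhedral convex function, and $C\subset X$ a nonempty closed convex set. Consider the problem of minimizing $f(x):=g(x)-h(x)$ over $x\in C$. If $C\subset\mathrm{dom}\,g$ and $C\subset\mathrm{int}(\mathrm{dom}\,h)$, then the local solution set $\mathcal S_1$ of this problem is the union of finitely many convex subsets of $C$, while the global solution set $\mathcal S$ of the problem is the union of finitely many closed convex subsets of $C$.
   Context: $\overline{\mathbb R}=\mathbb R\cup\{\pm\infty\}$. $\mathrm{dom}\,\varphi=\{x\mid\varphi(x)<+\infty\}$, $\mathrm{epi}\,\varphi=\{(x,\alpha)\in X\times\mathbb R\mid x\in\mathrm{dom}\,\varphi,\ \varphi(x)\le\alpha\}$; $\varphi$ is proper if $\mathrm{dom}\,\varphi\ne\emptyset$ and $\varphi>-\infty$ everywhere; $\mathrm{int}$ denotes interior. A subset of a locally convex Hausdorff topological vector space $Z$ is generalized polyhedral convex if it has the form $\{z\in L\mid\langle z_k^*,z\rangle\le\alpha_k,\ k=1,\dots,p\}$ with $L\subset Z$ a closed affine subspace, $z_k^*\in Z^*$ (the topological dual), $\alpha_k\in\mathbb R$. A function $\varphi:X\to\overline{\mathbb R}$ is generalized polyhedral convex if $\mathrm{epi}\,\varphi$ is a generalized polyhedral convex set in $X\times\mathbb R$. $\mathcal S$ is the set of $\bar x\in C$ with $f(\bar x)\le f(x)$ for all $x\in C$; $\mathcal S_1$ is the set of $\bar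 x\in C$ for which there is a neighborhood $U$ of $\bar x$ with $f(\bar x)\le f(x)$ for all $x\in C\cap U$. Either set may be empty. *)

(* Defs.v *)
From mathcomp Require Import all_boot all_order all_algebra.
From mathcomp Require Import all_classical all_reals all_analysis.

Set Implicit Arguments.
Unset Strict Implicit.
Unset Printing Implicit Defensive.

Import Order.TTheory GRing.Theory Num.Theory.
Import numFieldNormedType.Exports.

Local Open Scope classical_set_scope.
Local Open Scope ring_scope.

(* A translate of a linear subspace; in particular it is nonempty. *)
Definition affine_subspace (R : realType) (Z : lmodType R) (L : set Z) : Prop :=
  exists (z0 : Z) (M : set Z),
    GRing.submod_closed (mem M) /\ L = [set z0 + m | m in M].

(* The elements of the topological dual are the continuous linear maps into
   R^o, i.e. R regarded as a topological vector space over itself. *)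
Definition generalized_polyhedral_convex_set (R : realType) (Z : tvsType R)
    (D : set Z) : Prop :=
  exists (L : set Z) (p : nat) (zs : 'I_p -> {linear Z -> R^o})
         (alpha : 'I_p -> R),
    [/\ affine_subspace L, closed L,
        forall k, continuous (zs k : Z -> R^o) &
        D = [set z | L z /\ forall k, zs k z <= alpha k]].

Definition edom (R : realType) (T : Type) (phi : T -> \bar R) : set T :=
  [set x | (phi x < +oo)%E].

Definition epigraph (R : realType) (T : Type) (phi : T -> \bar R) :
    set (T * R^o) :=
  [set xa | edom phi xa.1 /\ (phi xa.1 <= (xa.2 : R)%:E)%E].

Definition proper_efun (R : realType) (T : Type) (phi : T -> \bar R) : Prop :=
  edom phi !=set0 /\ forall x, (-oo < phi x)%E.

(* The library's convex_function only covers real-valued functions. *)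
Definition convex_efun (R : realType) (X : lmodType R) (phi : X -> \bar R) :
    Prop :=
  convex_set (epigraph phi).

Definition generalized_polyhedral_convex_efun (R : realType) (X : tvsType R)
    (phi : X -> \bar R) : Prop :=
  generalized_polyhedral_convex_set (epigraph phi).

Definition global_solutions (R : realType) (T : Type) (f : T -> \bar R)
    (C : set T) : set T :=
  [set x | C x /\ forall y, C y -> (f x <= f y)%E].

Definition local_solutions (R : realType) (X : topologicalType)
    (f : X -> \bar R) (C : set X) : set X :=
  [set x | C x /\
    exists2 U, nbhs x U & forall y, (C `&` U) y -> (f x <= f y)%E].

(* Main.v *)
Require Import Defs.
From mathcomp Require Import all_boot all_order all_algebra.
From mathcomp Require Import all_classical all_reals all_analysis.
From mathcomp Require Import ring lra.

Import Order.TTheory GRing.Theory Num.Theory.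
Import numFieldNormedType.Exports.

Local Open Scope classical_set_scope.
Local Open Scope ring_scope.
Local Open Scope convex_scope.

Set Implicit Arguments.
Unset Strict Implicit.

(** On the feasible set a generalized polyhedral convex [h] is a maximum of
    finitely many continuous affine functions [l i], because each defining
    inequality of its epigraph that really involves the vertical coordinate
    can be solved for it ([gpc_max]). There the objective is therefore a
    minimum of finitely many convex functions [g - l i], and both solution
    sets can be read off the minimizers of these.

    For global solutions, [x] is one as soon as some [g x - l i x] is at most
    every value of the objective. For a fixed [i] this is an intersection of
    sublevel sets of the function [g - l i], which is convex and lower
    semicontinuous; hence the pieces are convex and closed, and there is one
    for each [i] ([global_min_pieces]).

    For local solutions, call [i] active at [x] when [l i x = h x]. By
    continuity only indices active at [x] are active near [x], so [x] is a
    local solution exactly when it is a local minimizer over [C] of [g - l j]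
    for every active [j]. By convexity [x] then minimizes [g - l j] over all of
    [C] ([local_min_convex]), and this condition no longer refers to a
    neighborhood. The points whose active set is a given [J] form a convex set,
    described by equalities and strict inequalities between the [l i], so there
    is one convex piece for each nonempty [J] ([local_min_pieces]). The strict
    inequalities are why these pieces need not be closed. *)

(** * Generalized polyhedral convex functions as maxima of affine functions *)

(** Stating affinity as preservation of convex combinations avoids choosing a
    linear part and a constant for each function. *)
Definition affine_fun (R : realType) (X : lmodType R)
    (l : convex_lmodType X -> R^o) :=
  forall t : {i01 R}, {morph l : x y / x <| t |> y}.

Lemma affine_subspace_line (R : realType) (Z : lmodType R) (L : set Z)
    (u v : Z) (s : R) :
  affine_subspace L -> L u -> L v -> L (u + s *: (v - u)).
Proof.
move=> [z0 [M [[_ Mlin] ->]]] [a Ma <-] [b Mb <-].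
exists (a + s *: (b - a)).
  have inM d : M d -> d \in mem M by move=> Md; exact: mem_set.
  have Mba : b - a \in mem M.
    by rewrite addrC -scaleN1r; apply: Mlin; exact: inM.
  by rewrite addrC; have /set_mem := Mlin s _ a Mba (inM _ Ma).
by rewrite [_ + b]addrC addrKA -addrA.
Qed.

Section affine_max.
Context {R : realType} {X : tvsType R}.

Lemma linear_prod_split (z : {linear (X * R^o)%type -> R^o}) (x : X) (a : R) :
  z (x, a) = z (x, 0) + z (0, 1) * a.
Proof.
have -> : (x, a) = (x, 0) + a *: (0, 1) :> (X * R^o)%type.
  by congr pair => /=; rewrite ?scaler0 ?addr0 // add0r [RHS]mulr1.
by rewrite linearD linearZ /= [in RHS]mulrC.
Qed.

(** The coefficient [c k] of the vertical coordinate in the [k]-th inequality is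
    nonpositive, since an epigraph is unbounded upwards. Inequalities with
    [c k < 0] give the affine functions; those with [c k = 0] only describe the
    domain and hold automatically at its points.
    Over a point of the domain, the affine subspace contains two points of the
    epigraph on the same vertical line, hence the whole line. *)
Lemma gpc_epigraph (h : X -> \bar R) :
  generalized_polyhedral_convex_efun h ->
  exists (I : finType) (l : I -> X -> R^o),
    (forall i, continuous (l i) /\ affine_fun (l i)) /\
    forall x, edom h x ->
      forall a : R, (h x <= a%:E)%E <-> forall i, l i x <= a.
Proof.
move=> [L [p [z [alpha [affL _ cz epiE]]]]].
pose c k : R := z k (0, 1).
pose I : finType := {k : 'I_p | c k < 0}.
pose l (i : I) (x : X) : R^o :=
  (z (val i) (x, 0) - alpha (val i)) / - c (val i).
have epiP x a : edom h x -> (h x <= a%:E)%E <->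
    L (x, a) /\ forall k, z k (x, 0) + c k * a <= alpha k.
  move=> hx; have -> : (h x <= a%:E)%E <-> epigraph h (x, a).
    by split=> [|[]].
  rewrite epiE; split=> -[Lxa zxa]; split=> // k; have := zxa k;
    by rewrite (linear_prod_split _ x a).
exists I, l; split=> [i|x hx a].
  split.
    move=> x; apply: cvgM; last exact: cvg_cst.
    apply: cvgB; last exact: cvg_cst.
    apply: (@continuous_comp _ _ _ (fun x : X => (x, 0 : R^o)) (z (val i))).
      by apply: (cvg_pair (G := nbhs x) (H := nbhs (0 : R^o)));
        [exact: cvg_id|exact: cvg_cst].
    exact: cz.
  move=> t x y /=.
  have -> : l i (x <| t |> y) =
     (z (val i) (t%:num *: (x, 0) + (1 - t%:num) *: (y, 0)) - alpha (val i))
         / - c (val i).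
    by congr ((z _ _ - _) / _); congr pair; rewrite /= ?scaler0 ?addr0.
  by rewrite linearD !linearZ /= convRE /l /GRing.scale /= /unstable.onem; ring.
have [b hb] : exists b : R, (h x <= b%:E)%E.
  move: hx; rewrite /edom /=; case: (h x) => [r _| |_] //; first by exists r.
  by exists 0; rewrite leNye.
have [Lb zb] := (epiP x b hx).1 hb.
have hb1 : (h x <= (b + 1)%:E)%E.
  by rewrite (le_trans hb) // lee_fin lerDl.
have [Lb1 _] := (epiP x _ hx).1 hb1.
have Lx a' : L (x, a').
  have := affine_subspace_line (a' - b) affL Lb Lb1.
  congr (L _); congr pair; first by rewrite /= subrr scaler0 addr0.
  by rewrite /= /GRing.scale /=; ring.
have c_le0 k : c k <= 0.
  rewrite leNgt; apply/negP => ck.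
  (* a height in the epigraph that violates the k-th inequality *)
  pose a' := Num.max b ((alpha k + 1 - z k (x, 0)) / c k).
  have : (h x <= a'%:E)%E by rewrite (le_trans hb) // lee_fin le_max lexx.
  move=> /(epiP x _ hx) [_ /(_ k)]; apply/negP; rewrite -ltNge.
  have : (alpha k + 1 - z k (x, 0)) / c k <= a' by rewrite le_max lexx orbT.
  rewrite ler_pdivrMr // mulrC; lra.
rewrite epiP //; split=> [[_ za] i|la].
  have ci := valP i; rewrite /l ler_pdivrMr ?oppr_gt0 //.
  by have := za (val i); rewrite mulrN mulrC; lra.
split=> // k; have := c_le0 k; rewrite le_eqVlt => /orP[/eqP ck|ck].
  by have := zb k; rewrite ck !mul0r.
have := la (exist _ k ck); rewrite /l /= ler_pdivrMr ?oppr_gt0 //.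
by rewrite mulrN mulrC; lra.
Qed.

(** Properness makes the index type nonempty: without any [l i], every real
    would be an upper bound of [h x]. *)
Lemma gpc_max (h : X -> \bar R) :
  proper_efun h -> generalized_polyhedral_convex_efun h ->
  exists (I : finType) (l : I -> X -> R^o),
    (forall i, continuous (l i) /\ affine_fun (l i)) /\
    forall x, edom h x ->
      (forall i, ((l i x)%:E <= h x)%E) /\ exists i, h x = (l i x)%:E.
Proof.
move=> [_ h_gtNy] /gpc_epigraph[I [l [lP hP]]].
exists I, l; split=> // x hx.
have {}hP := hP x hx.
have [r hr] : exists r : R, h x = r%:E.
  move: hx (h_gtNy x); rewrite /edom /=.
  by case: (h x) => [r| |] // _ _; exists r.
have l_le i : l i x <= r by apply: (hP r).1; rewrite hr.
split=> [i|]; first by rewrite hr lee_fin.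
have [i0 _|I0] := pickP (@predT I); last first.
  have : (h x <= (r - 1)%:E)%E by apply/hP => i; have := I0 i.
  by rewrite hr lee_fin; lra.
have [i _ imax] := @arg_maxP _ R I i0 predT (l^~ x) isT.
exists i; apply/eqP; rewrite eq_le {2}hr lee_fin l_le andbT.
by apply/hP => j; exact: imax.
Qed.
End affine_max.

(** * Local minimizers of convex functions *)

Section convex_minimizers.
Context {R : realType} {X : tvsType R}.
Implicit Types (C : set X) (phi : X -> R^o).

Lemma cvg_segment (x v : X) : x + (t : R^o) *: v @[t --> (0 : R)^'+] --> x.
Proof.
rewrite -[X in _ --> X]addr0 -[X in _ --> _ + X](scale0r v).
apply: (@continuous2_cvg _ _ _ _ _ _ _ _ (fun a b : X => a + b)).
- exact: (add_continuous (x, (0 : R^o) *: v)).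
- exact: cvg_cst.
apply: (@continuous2_cvg _ _ _ _ _ _ _ _ (fun (a : R^o) (b : X) => a *: b)).
- exact: (scale_continuous (0 : R^o, v)).
- exact: cvg_at_right_filter.
- exact: cvg_cst.
Qed.

(** A short step from [x] towards [y] stays in the neighborhood, and there
    convexity bounds [phi] by an average of [phi x] and [phi y] in which [phi y]
    has positive weight. *)
Lemma local_min_convex C phi x U :
  convex_set C -> convex_function C phi -> C x -> nbhs x U ->
  (forall y, (C `&` U) y -> phi x <= phi y) ->
  forall y, C y -> phi x <= phi y.
Proof.
move=> Ccvx phicvx Cx Ux xmin y Cy.
have : \forall t \near (0 : R)^'+, U (x + t *: (y - x)) /\ (0 < t < 1).
  near=> t; split; first by near: t; exact: (cvg_segment (y - x) Ux).
  apply/andP; split; near: t; [exact: nbhs_right_gt|exact: nbhs_right_lt].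
move=> /filter_ex[t [Ut /andP[t0 t1]]].
pose t' : {i01 R} := Itv01 (ltW t0) (ltW t1).
have tE : (y : convex_lmodType X) <| t' |> x = x + t *: (y - x).
  by rewrite /conv /= /unstable.onem scalerBl scale1r scalerBr addrCA.
have yC : (y : convex_lmodType X) \in C by exact: mem_set.
have xC : (x : convex_lmodType X) \in C by exact: mem_set.
have Cz := set_mem (Ccvx _ _ t' yC xC).
have := xmin _ (conj Cz _); rewrite tE => /(_ Ut).
have := phicvx t' _ _ yC xC; rewrite convRE tE /= /unstable.onem.
move=> h1 h2; have : t * phi x <= t * phi y by lra.
by rewrite ler_pM2l.
Unshelve. all: by end_near.
Qed.
End convex_minimizers.

(** * Convex functions minus a maximum of affine functions *)

Lemma conv_le_ub (R : realType) (t : {i01 R}) (a b c : R^o) :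
  a <= c -> b <= c -> a <| t |> b <= c.
Proof.
move=> ac bc; have t0 : 0 <= t%:num by []; have t1 : t%:num <= 1 by [].
by rewrite convRE /unstable.onem; nra.
Qed.

Lemma convex_function_sub_affine (R : realType) (X : lmodType R) (C : set X)
    (G l : X -> R^o) :
  convex_function C G -> affine_fun l -> convex_function C (G \- l).
Proof.
move=> G_convex l_affine t x y xC yC /=; have := G_convex t x y xC yC.
by rewrite l_affine !convRE /=; lra.
Qed.

Section dc_pieces.
Context {R : realType} {X : tvsType R} (C : set X) (I : finType).
Variables (G H : X -> R^o) (l : I -> X -> R^o).
Hypothesis C_convex : convex_set C.
Hypothesis G_convex : convex_function C G.
Hypothesis l_continuous : forall i, continuous (l i).
Hypothesis l_affine : forall i, affine_fun (l i).
Hypothesis l_le : forall x, C x -> forall i, l i x <= H x.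
Hypothesis l_active : forall x, C x -> exists i, H x = l i x.

Let G_sub_convex i : convex_function C (G \- l i).
Proof. exact: convex_function_sub_affine. Qed.

(** Comparing with all values [G y - H y], and not with the optimal value, gives
    a definition that also makes sense when there is no solution. *)
Definition global_piece i : set X :=
  [set x | C x /\ forall y, C y -> G x - l i x <= G y - H y].

Lemma convex_global_piece i : convex_set (global_piece i).
Proof.
move=> x y t /set_mem[Cx xmin] /set_mem[Cy ymin]; apply/mem_set.
have xC := mem_set Cx; have yC := mem_set Cy; split=> [|w Cw].
  exact: set_mem (C_convex t xC yC).
apply: le_trans (G_sub_convex i t xC yC) _.
by apply: conv_le_ub => /=; [exact: xmin|exact: ymin].
Qed.

Lemma global_min_pieces :
  [set x | C x /\ forall y, C y -> G x - H x <= G y - H y] =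
  \bigcup_i global_piece i.
Proof.
apply/seteqP; split=> [x [Cx xmin]|x [i _ [Cx xmin]]].
  by have [i Hx] := l_active Cx; exists i => //; split=> //; rewrite -Hx.
split=> // y Cy; apply: le_trans (xmin y Cy).
by rewrite lerD2l lerN2; exact: l_le.
Qed.

(** The equalities and strict inequalities say that [J] is the active set of [x],
    in a form that is preserved by convex combinations. *)
Definition local_piece (J : {set I}) : set X :=
  [set x | [/\ C x, J != finset.set0 & forall j, j \in J ->
    [/\ forall y, C y -> G x - l j x <= G y - l j y,
        forall i, i \in J -> l i x = l j x &
        forall i, i \notin J -> l i x < l j x]]].

Lemma convex_local_piece J : convex_set (local_piece J).
Proof.
move=> x y t /set_mem[Cx J0 xJ] /set_mem[Cy _ yJ]; apply/mem_set.
have xC := mem_set Cx; have yC := mem_set Cy; split=> // [|j jJ].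
  exact: set_mem (C_convex t xC yC).
have [xmin xeq xlt] := xJ j jJ; have [ymin yeq ylt] := yJ j jJ.
split=> [w Cw|i iJ|i iJ].
- apply: le_trans (G_sub_convex j t xC yC) _.
  by apply: conv_le_ub => /=; [exact: xmin|exact: ymin].
- by rewrite !l_affine xeq // yeq.
- have : 0 < (l j x - l i x : R^o) <| t |> (l j y - l i y).
    by apply: convR_gt0; rewrite subr_gt0; [exact: xlt|exact: ylt].
  by rewrite !l_affine !convRE; lra.
Qed.

Lemma local_min_pieces :
  [set x | C x /\ exists2 U, nbhs x U &
     forall y, (C `&` U) y -> G x - H x <= G y - H y] =
  \bigcup_J local_piece J.
Proof.
apply/seteqP; split=> [x [Cx [U Ux xmin]]|x [J _ [Cx J0 xJ]]].
  have [k Hk] := l_active Cx.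
  exists [set i | l i x == H x]%SET => //; split=> //.
    by apply/set0Pn; exists k; rewrite inE Hk.
  move=> j; rewrite inE => /eqP lj; split=> [y Cy|i|i].
  - apply: (local_min_convex C_convex (G_sub_convex j) Cx Ux) Cy.
    move=> {}y [Cy Uy] /=; rewrite lj.
    apply: le_trans (xmin y (conj Cy Uy)) _.
    by rewrite lerD2l lerN2; exact: l_le.
  - by rewrite inE => /eqP ->.
  - by rewrite inE lj lt_neqAle => -> /=; exact: l_le.
split=> //.
(* near x every index outside J stays below those in J, so is inactive *)
exists [set y | forall i j, i \notin J -> j \in J -> l i y < l j y].
  apply: filter_forall => i; apply: filter_forall => j.
  have [iJ|iJ] := boolP (i \in J); first exact: nearW.
  have [jJ|jJ] := boolP (j \in J); last exact: nearW.
  have [_ _ /(_ i iJ) lij] := xJ j jJ.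
  have : (l j \- l i) y @[y --> x] --> l j x - l i x.
    by apply: cvgB; exact: l_continuous.
  move=> /cvgr_gt/(_ 0); rewrite subr_gt0 => /(_ lij).
  by apply: filterS => y /=; rewrite subr_gt0.
move=> y [Cy Uy]; have [i Hy] := l_active Cy; have [k Hx] := l_active Cx.
have /set0Pn[j jJ] := J0.
have iJ : i \in J.
  apply/negPn/negP => iJ; have := Uy i j iJ jJ.
  by rewrite -Hy ltNge l_le.
have kJ : k \in J.
  apply/negPn/negP => kJ; have [_ _ /(_ k kJ)] := xJ j jJ.
  by rewrite -Hx ltNge l_le.
have [xmin xeq _] := xJ i iJ.
by rewrite Hx Hy xeq //; exact: xmin.
Qed.

End dc_pieces.

(** * Extended-real functions *)

Lemma closed_le_lsc (R : realType) (X : topologicalType) (g : X -> \bar R)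
    (u : X -> R^o) :
  lower_semicontinuous g -> continuous u ->
  closed [set x | (g x <= (u x)%:E)%E].
Proof.
move=> g_lsc uc; rewrite -[X in closed X]setCK; apply: open_closedC.
rewrite openE => x /= /negP; rewrite -ltNge => ux.
have [a ua ag] : exists2 a : R, u x < a & (a%:E < g x)%E.
  move: ux; case: (g x) => [r| |] //; last first.
    by exists (u x + 1); rewrite ?ltrDl ?ltry.
  by rewrite lte_fin => ur; exists ((u x + r) / 2); rewrite ?lte_fin; lra.
have [V Vx Vg] := g_lsc x a ag.
have : \forall y \near x, u y < a by have /cvgr_lt := uc x; exact.
rewrite /interior; apply: filterS2 Vx => y /Vg ay uy.
by apply/negP; rewrite -ltNge; apply: lt_trans ay; rewrite lte_fin.
Qed.

Lemma convex_efun_fine (R : realType) (X : tvsType R) (g : X -> \bar R)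
    (C : set X) :
  (forall x, (-oo < g x)%E) -> convex_efun g -> convex_set C -> C `<=` edom g ->
  convex_function C (fine \o g : X -> R^o).
Proof.
move=> gNy gcvx Ccvx Cg t x y xC yC /=.
have gfin w : C w -> g w = (fine (g w))%:E.
  by move=> /Cg; rewrite /edom /=; have := gNy w; case: (g w).
have epi w : w \in C -> (w, fine (g w)) \in epigraph g.
  move=> /set_mem Cw; apply/mem_set; split=> /=; first exact: Cg.
  by rewrite -gfin.
have /set_mem[/= _] := gcvx _ _ t (epi x xC) (epi y yC).
by rewrite gfin ?lee_fin //; exact: set_mem (Ccvx _ _ t xC yC).
Qed.

Lemma bigcup_enum_val (T : Type) (J : finType) (A : J -> set T) :
  \bigcup_j A j = \bigcup_(i : 'I_#|J|) A (enum_val i).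
Proof.
apply/seteqP; split=> [x [j _ Ax]|x [i _ Ax]]; last by exists (enum_val i).
by exists (enum_rank j) => //; rewrite enum_rankK.
Qed.

(** * Local and global solution sets *)

Theorem theorem4p1 (R : realType) (X : tvsType R) (g h : X -> \bar R)
    (C : set X)
    (X_hausdorff : hausdorff_space X)
    (g_lsc : lower_semicontinuous g)
    (g_proper : proper_efun g)
    (g_convex : convex_efun g)
    (h_proper : proper_efun h)
    (h_gpc : generalized_polyhedral_convex_efun h)
    (C_neq0 : C !=set0)
    (C_closed : closed C)
    (C_convex : convex_set C)
    (C_dom_g : C `<=` edom g)
    (C_int_dom_h : C `<=` interior (edom h)) :
  let f := fun x : X => (g x - h x)%E in
  (exists (n : nat) (A : 'I_n -> set X),
     (forall i, convex_set (A i) /\ A i `<=` C) /\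
     local_solutions f C = \bigcup_i A i) /\
  (exists (n : nat) (A : 'I_n -> set X),
     (forall i, [/\ closed (A i), convex_set (A i) & A i `<=` C]) /\
     global_solutions f C = \bigcup_i A i).
Proof.
move=> f.
have [I [l [lP hP]]] := gpc_max h_proper h_gpc.
have C_dom_h x : C x -> edom h x by move=> /C_int_dom_h/interior_subset.
pose G x : R^o := fine (g x); pose H x : R^o := fine (h x).
have gE x : C x -> g x = (G x)%:E.
  by move=> /C_dom_g; rewrite /edom /= /G; have := g_proper.2 x; case: (g x).
have fE x : C x -> f x = (G x - H x)%:E.
  move=> Cx; have [_ [i hx]] := hP x (C_dom_h x Cx).
  by rewrite /f gE // /H hx.
have l_le x : C x -> forall i, l i x <= H x.
  move=> Cx i; have [hx [k hk]] := hP x (C_dom_h x Cx).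
  by have := hx i; rewrite /H hk lee_fin.
have l_active x : C x -> exists i, H x = l i x.
  by move=> /C_dom_h/hP[_ [i hx]]; exists i; rewrite /H hx.
have l_cont i := (lP i).1; have l_aff i := (lP i).2.
have G_convex : convex_function C G.
  exact: convex_efun_fine g_proper.2 g_convex C_convex C_dom_g.
split.
  exists #|{set I}|, (fun i => local_piece C G l (enum_val i)).
  split=> [i|]; first by split; [exact: convex_local_piece|move=> x []].
  rewrite -bigcup_enum_val.
  rewrite -(local_min_pieces C_convex G_convex l_cont l_aff l_le l_active).
  apply/seteqP; split=> x [Cx [U Ux xmin]]; split=> //; exists U => // y CUy.
    by have := xmin y CUy; rewrite !fE ?lee_fin //; case: CUy.
  by rewrite !fE ?lee_fin; [exact: xmin| case: CUy|].
exists #|I|, (fun i => global_piece C G H l (enum_val i)).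
split=> [i|]; last first.
  rewrite -bigcup_enum_val -(global_min_pieces _ l_le l_active).
  apply/seteqP; split=> x [Cx xmin]; split=> // y Cy.
    by have := xmin y Cy; rewrite !fE ?lee_fin.
  by rewrite !fE ?lee_fin; [exact: xmin| |].
split; [|exact: convex_global_piece|by move=> x []].
have -> : global_piece C G H l (enum_val i) = C `&` \bigcap_(y in C)
    [set x | (g x <= (l (enum_val i) x + (G y - H y))%:E)%E].
  apply/seteqP; split=> x [Cx xmin]; split=> // y Cy.
    by rewrite /= gE // lee_fin -lerBlDl; exact: xmin.
  by have := xmin y Cy; rewrite /= gE // lee_fin -lerBlDl.
apply: closedI => //; apply: closed_bigI => y Cy.
apply: closed_le_lsc => // x; apply: cvgD; last exact: cvg_cst.
exact: l_cont.
Qed.
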